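(* Let $\Omega_c=\bigcup_{j\in\mathbb N}[a_j,b_j]$ with $(a_j)$ unbounded and $0=a_1<b_1\le a_2<b_2\le\cdots$, let $(k_j)_{j\in\mathbb N}\subset\mathbb R_{>0}$ be bounded, $k_B=\sum_jk_j\chi_{[a_j,b_j]}$, and for $L>0$ let $$\mathcal T^\varphi_{\Omega_L}(t)x^0=\exp\Big(-\frac1c\int_{\cdot-ct}^{\cdot}P_{\Omega_L}(k_B|_{[0,L]})(y)\,dy\Big)P_{\Omega_L}(x^0)(\cdot-ct),\qquad x^0\in L^2(\Omega_L),\ t\ge0,$$ be the closed-loop semigroup on $L^2(\Omega_L)$. The following are equivalent: (i) There exist $\tilde M,\tilde k>0$ with $\|\mathcal T^\varphi_{\Omega_L}(t)\|_{L(L^2(\Omega_L))}\le\tilde Me^{-\tilde kt}$ for all $L>0$ and $t\ge0$. (ii) There exist $M,k>0$ such that for all $n,m\in\mathbb N$ with $n\ge m$: $k(a_n-b_m)-\sum_{j=m+1}^{n-1}k_j(b_j-a_j)\le M$.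
   Context: $c>0$ constant, $\Omega_L=[0,L]$. $P_{\Omega_L}(f)$ denotes the $L$-periodic extension to $\mathbb R$ of a function $f$ on $[0,L]$ ($P_{\Omega_L}(f)(\omega)=f(\omega-jL)$ for $\omega\in(jL,(j+1)L]$, $j\in\mathbb Z$). $\mathcal T^\varphi_{\Omega_L}$ is the semigroup of the transport equation $\partial_tx=-k_Bx-c\partial_\omega x$ on $[0,L]$ with periodic boundary condition $x(0,t)=x(L,t)$. *)

(* Defs.v *)
From HB Require Import structures.
From mathcomp Require Import all_boot all_order all_algebra.
From mathcomp Require Import all_classical all_reals all_analysis.
Set Implicit Arguments. Unset Strict Implicit. Unset Printing Implicit Defensive.
Import Order.TTheory GRing.Theory Num.Theory.
Local Open Scope classical_set_scope.
Local Open Scope ring_scope.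

(* k_B = sum_j k_j * chi_[a_j,b_j] (series; locally only finitely many nonzero terms) *)
Definition kB (R : realType) (a b k : nat -> R) (w : R) : R :=
  limn (fun n => \sum_(0 <= j < n) k j * (\1_(`[a j, b j]%classic) w : R)).

(* L-periodic extension: P f w = f (w - j L) for w in (jL, (j+1)L], i.e. j = ceil(w/L) - 1 *)
Definition Pext (R : realType) (L : R) (f : R -> R) (w : R) : R :=
  f (w - ((Num.ceil (w / L) - 1)%:~R * L)).

Definition Tphi (R : realType) (c : R) (a b k : nat -> R) (L t : R)
  (x0 : R -> R) (w : R) : R :=
  expR (- (c^-1) * Rintegral (@lebesgue_measure R) `[w - c * t, w]%classic
                     (Pext L (kB a b k)))
  * Pext L x0 (w - c * t).

Definition L2sq (R : realType) (L : R) (f : R -> R) : \bar R :=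
  (\int[@lebesgue_measure R]_(x in `[0%R, L]%classic) ((f x) ^+ 2)%:E)%E.

(* Main.v *)
Require Import Defs.
From HB Require Import structures.
From mathcomp Require Import all_boot all_order all_algebra.
From mathcomp Require Import all_classical all_reals all_analysis.
From mathcomp Require Import measurable_realfun ring lra.
Set Implicit Arguments. Unset Strict Implicit. Unset Printing Implicit Defensive.
Import Order.TTheory GRing.Theory Num.Theory.
Import numFieldNormedType.Exports.
Local Open Scope classical_set_scope.
Local Open Scope ring_scope.

(** The norm of the semigroup at time t is governed by the integral of the
periodised damping over windows of length ct.  Condition (ii) only sees windows
[b_m, a_n]; but w |-> int_0^w k_B - k w is piecewise affine and decreasing on the
gaps, so its worst drops occur between such points, which gives the bound
int_x^y k_B >= k (y - x) - B on every window inside [0, L].  A window of the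
periodised damping consists of at most two partial periods and a number of whole
periods; to avoid losing B on each whole period one needs
int_0^L k_B >= k' L uniformly in L, which follows from the previous bound for
large L and from a_1 = 0 < b_1 for small L.  Conversely, (i) applied to
narrow pulses travelling from b_m to a_n yields (ii). *)

(** * The accumulated damping *)

Definition actuators (R : realType) (a b : nat -> R) :=
  [/\ a 0%N = 0, forall j, a j < b j & forall j, b j <= a j.+1].

Definition gain (R : realType) (a b k : nat -> R) (n : nat) : R :=
  \sum_(0 <= j < n) k j * (b j - a j).

(* The antiderivative of [kB] vanishing at 0; it is independent of the
   truncation level [N] on [0, a_N]. *)
Definition cumk (R : realType) (a b k : nat -> R) (N : nat) (w : R) : R :=
  \sum_(0 <= j < N) k j * (Num.min w (b j) - Num.min w (a j)).

Definition gap_bound (R : realType) (a b k : nat -> R) (M kk : R) :=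
  forall n m : nat, (m <= n)%N ->
    kk * (a n - b m) - \sum_(m.+1 <= j < n) k j * (b j - a j) <= M.

Lemma gainS (R : realType) (a b k : nat -> R) n :
  gain a b k n.+1 = gain a b k n + k n * (b n - a n).
Proof. by rewrite /gain big_nat_recr. Qed.

Lemma sum_gain (R : realType) (a b k : nat -> R) m n : (m <= n)%N ->
  \sum_(m <= j < n) k j * (b j - a j) = gain a b k n - gain a b k m.
Proof.
by move=> mn; rewrite /gain [in RHS](big_cat_nat (leq0n m) mn) addrC addrA addNr add0r.
Qed.

Lemma actuators_le (R : realType) (a b : nat -> R) : actuators a b ->
  {homo a : m n / (m <= n)%N >-> m <= n}.
Proof.
move=> [_ ab ba]; apply: homo_leq => [x|y x z|j]; [exact: lexx|exact: le_trans|].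
exact: le_trans (ltW (ab j)) (ba j).
Qed.

Lemma actuators_index (R : realType) (a b : nat -> R) N w : actuators a b ->
  0 <= w -> w < a N -> exists m, [/\ (m < N)%N, a m <= w & w < a m.+1].
Proof.
move=> [a0 _ _] w0; elim: N => [|N IH] wN; first by move: wN; rewrite a0 ltNge w0.
have [wN'|Nw] := ltP w (a N); last by exists N.
by have [m [mN ? ?]] := IH wN'; exists m; rewrite ltnS (ltnW mN).
Qed.

(** Between [a m] and [a m.+1] the summands of index below [m] are saturated and those above [m]
    still vanish, so only actuator [m] varies. *)
Lemma cumkE (R : realType) (a b k : nat -> R) N m w : actuators a b ->
  (m < N)%N -> a m <= w -> w <= a m.+1 ->
  cumk a b k N w = gain a b k m + k m * (Num.min w (b m) - a m).
Proof.
move=> act mN mw wm; have [_ ab ba] := act.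
rewrite /cumk (big_cat_nat (leq0n m) (ltnW mN)) /=.
rewrite (big_ltn mN); congr (_ + _).
  apply: eq_big_nat => j /andP[_ jm].
  have bjw : b j <= w by rewrite (le_trans (ba j))// (le_trans _ mw)// (actuators_le act).
  by rewrite (min_idPr bjw) (min_idPr (le_trans (ltW (ab j)) bjw)).
rewrite (min_idPr mw) big_nat big1 ?addr0// => j /andP[mj _].
have wj : w <= a j by rewrite (le_trans wm)// (actuators_le act).
by rewrite (min_idPl wj) (min_idPl (le_trans wj (ltW (ab j)))) subrr mulr0.
Qed.

Lemma cumk_node (R : realType) (a b k : nat -> R) N n : actuators a b ->
  (n <= N)%N -> cumk a b k N (a n) = gain a b k n.
Proof.
move=> act; have [a0 ab ba] := act; rewrite leq_eqVlt => /orP[/eqP->|nN].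
  apply: eq_big_nat => j /andP[_ jN].
  have bj : b j <= a N by rewrite (le_trans (ba j))// (actuators_le act).
  by rewrite (min_idPr bj) (min_idPr (le_trans (ltW (ab j)) bj)).
rewrite (@cumkE _ _ _ _ _ n)// ?(actuators_le act)//.
by rewrite (min_idPl (ltW (ab n))) subrr mulr0 addr0.
Qed.

Lemma cumk0 (R : realType) (a b k : nat -> R) N : actuators a b ->
  cumk a b k N 0 = 0.
Proof.
move=> act; have [a0 _ _] := act.
by rewrite -a0 cumk_node// /gain big_geq.
Qed.

Lemma ler_min_diff (R : realType) (p q x y : R) : p <= q -> x <= y ->
  Num.min x q - Num.min x p <= Num.min y q - Num.min y p.
Proof. by move=> pq xy; rewrite !minElt; do 4 case: ltP => ?; lra. Qed.

Lemma le_cumk (R : realType) (a b k : nat -> R) N : actuators a b ->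
  (forall j, 0 < k j) -> {homo cumk a b k N : x y / x <= y}.
Proof.
move=> [_ ab _] k0 x y xy; apply: ler_sum => j _.
by rewrite ler_wpM2l ?(ltW (k0 j))// ler_min_diff// ltW.
Qed.

Lemma ge_cumk_head (R : realType) (a b k : nat -> R) N w : actuators a b ->
  (forall j, 0 < k j) -> (0 < N)%N -> 0 <= w ->
  k 0%N * Num.min w (b 0%N) <= cumk a b k N w.
Proof.
move=> [a0 ab _] k0 N0 w0; rewrite /cumk big_ltn// a0 (min_idPr w0) subr0.
rewrite lerDl; apply: sumr_ge0 => j _; apply: mulr_ge0; first exact: ltW.
rewrite subr_ge0 le_min !ge_min lexx ?orbT /=.
by rewrite (ltW (ab j)) orbT.
Qed.

(** Condition (ii) through increments of [gain]. The case [m = n] is left out: there the sum is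
    empty, while the difference of gains is [- k n * (b n - a n)]. *)
Lemma gap_boundE (R : realType) (a b k : nat -> R) M kk m n :
  gap_bound a b k M kk -> (m < n)%N ->
  kk * (a n - b m) <= gain a b k n - gain a b k m.+1 + M.
Proof.
move=> gap mn; have := gap _ _ (ltnW mn); rewrite sum_gain// => ?; lra.
Qed.

(** With the right end at a node, [x] is compared with an endpoint of its actuator at which
    condition (ii) applies. The extra [kk * b 0] pays for the first actuator, which has no
    predecessor. *)
Lemma ge_cumk_node (R : realType) (a b k : nat -> R) M kk N n x :
  actuators a b -> (forall j, 0 < k j) -> 0 < M -> 0 < kk ->
  gap_bound a b k M kk -> (n <= N)%N -> 0 <= x -> x <= a n ->
  kk * (a n - x) - (M + kk * b 0%N) <= cumk a b k N (a n) - cumk a b k N x.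
Proof.
move=> act kpos M0 kk0 gap nN x0; have [a0 ab ba] := act.
have b0 : 0 < b 0%N by rewrite -a0.
have kb0 : 0 < kk * b 0%N by rewrite mulr_gt0.
rewrite le_eqVlt => /orP[/eqP->|xn]; first by rewrite !subrr; lra.
have [m [mn mx xm]] := actuators_index act x0 xn.
have mN : (m < N)%N by exact: leq_trans nN.
rewrite cumk_node// (cumkE k act mN mx (ltW xm)).
have H1 := gap_boundE gap mn; move: H1; rewrite gainS => H1.
(* The damping vanishes in the gap after [b m], so moving [x] back to [b m] only strengthens the
   required bound. *)
have [bx|xb] := leP (b m) x.
  have : kk * b m <= kk * x by rewrite ler_pM2l.
  by lra.
(* In a strong actuator the stretch from [x] to [b m] meets the rate [kk] by itself. *)
have [kkm|mkk] := leP kk (k m).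
  have : kk * (b m - x) <= k m * (b m - x) by rewrite ler_wpM2r// subr_ge0 ltW.
  by lra.
(* In a weak actuator the stretch from its left end to [x] gains at most what [kk] demands, so the
   bound from the left end suffices; it follows from (ii) at the preceding actuator. In the first
   actuator, (ii) is used from [b 0] and the stretch from [x] to [b 0] is charged to [kk * b 0]. *)
have kx : k m * (x - a m) <= kk * (x - a m) by rewrite ler_wpM2r ?subr_ge0// ltW.
case: m mn mx xm mN H1 xb mkk kx => [|m] mn mx xm mN H1 xb mkk kx.
  have : 0 <= k 0%N * (b 0%N - x) by rewrite mulr_ge0 ?subr_ge0 ?(ltW xb) ?(ltW (kpos _)).
  have : 0 <= kk * x by rewrite mulr_ge0 ?(ltW kk0).
  by move: H1; rewrite a0 [gain _ _ _ 0]big_geq//; lra.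
have := gap_boundE gap (ltnW mn).
have : kk * b m <= kk * a m.+1 by rewrite ler_pM2l.
by lra.
Qed.

(* [w |-> cumk w - kk * w] is piecewise affine and decreasing on the gaps, so
   its drops are governed by the pairs (b_m, a_n). *)
Lemma ge_cumk (R : realType) (a b k : nat -> R) M kk N x y :
  actuators a b -> (forall j, 0 < k j) -> 0 < M -> 0 < kk ->
  gap_bound a b k M kk -> 0 <= x -> x <= y -> y < a N ->
  kk * (y - x) - (M + kk * b 0%N) <= cumk a b k N y - cumk a b k N x.
Proof.
move=> act kpos M0 kk0 gap x0 xy yN; have [a0 ab ba] := act.
have b0 : 0 < b 0%N by rewrite -a0.
have kb0 : 0 < kk * b 0%N by rewrite mulr_gt0.
have [n [nN ny yn]] := actuators_index act (le_trans x0 xy) yN.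
have Ky := cumkE k act nN ny (ltW yn).
have := ge_cumk_node act kpos M0 kk0 gap nN x0
  (ltW (le_lt_trans xy yn)).
rewrite cumk_node// gainS => HS.
(* Past [b n] nothing more is gained up to [a n.+1], so the node bound there suffices. *)
have [bny|ybn] := leP (b n) y.
  rewrite Ky (min_idPr bny).
  have : kk * y <= kk * a n.+1 by rewrite ler_pM2l// ltW.
  by lra.
(* In a weak actuator the remainder up to [a n.+1] gains too little, so the same node bound works.
   In a strong one [y] retreats to [a n], or to [x] when the whole window lies inside the
   actuator. *)
have [kkn|nkk] := leP kk (k n); last first.
  rewrite Ky (min_idPl (ltW ybn)).
  have : k n * (b n - y) <= kk * (b n - y) by rewrite ler_wpM2r ?subr_ge0// ltW.
  have : kk * b n <= kk * a n.+1 by rewrite ler_pM2l.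
  by lra.
have [xn|nx] := leP x (a n).
  have := ge_cumk_node act kpos M0 kk0 gap (ltnW nN) x0 xn.
  rewrite cumk_node ?(ltnW nN)// Ky (min_idPl (ltW ybn)).
  have : kk * (y - a n) <= k n * (y - a n) by rewrite ler_wpM2r ?subr_ge0.
  by lra.
rewrite Ky (cumkE k act nN (ltW nx) (ltW (le_lt_trans xy yn))).
rewrite (min_idPl (ltW ybn)) (min_idPl (le_trans xy (ltW ybn))).
have : kk * (y - x) <= k n * (y - x) by rewrite ler_wpM2r ?subr_ge0.
by lra.
Qed.

(* For short periods the bound comes from the first actuator, which starts at 0. *)
Lemma ge_cumk_period (R : realType) (a b k : nat -> R) M kk :
  actuators a b -> (forall j, 0 < k j) -> 0 < M -> 0 < kk ->
  gap_bound a b k M kk ->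
  exists2 kp, 0 < kp <= kk &
    forall L N, 0 < L -> L < a N -> kp * L <= cumk a b k N L.
Proof.
move=> act kpos M0 kk0 gap; have [a0 ab ba] := act.
have b0 : 0 < b 0%N by rewrite -a0.
have k0 := kpos 0%N.
pose B := M + kk * b 0%N.
have B0 : 0 < B by rewrite addr_gt0// mulr_gt0.
(* Three regimes: [kk / 2] serves [2 * B <= kk * L], where [B] eats at most half of [kk * L]; [k 0]
   serves [L <= b 0]; the last entry spreads the head gain [k 0 * b 0] over a length below
   [2 * B / kk]. *)
pose kp := Num.min (kk / 2) (Num.min (k 0%N) (k 0%N * b 0%N * (kk / (2 * B)))).
have kp1 : kp <= kk / 2 by rewrite ge_min lexx.
have kp2 : kp <= k 0%N by rewrite !ge_min lexx orbT.
have kp3 : kp <= k 0%N * b 0%N * (kk / (2 * B)) by rewrite !ge_min lexx !orbT.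
exists kp; first apply/andP; first split.
- by rewrite !lt_min k0 ?(mulr_gt0, invr_gt0).
- by rewrite (le_trans kp1)//; lra.
move=> L N L0 LN.
have N0 : (0 < N)%N by case: N LN => //; rewrite a0; lra.
have head := ge_cumk_head act kpos N0 (ltW L0).
have [BL|LB] := leP (2 * B) (kk * L).
  have := ge_cumk act kpos M0 kk0 gap (lexx _) (ltW L0) LN.
  rewrite cumk0// -/B.
  have : kp * L <= kk / 2 * L by rewrite ler_wpM2r// ltW.
  by lra.
apply: le_trans head; have [Lb|bL] := leP L (b 0%N).
  by rewrite ler_wpM2r// ltW.
apply: (@le_trans _ _ (k 0%N * b 0%N * (kk / (2 * B)) * L)).
  by rewrite ler_wpM2r// ltW.
rewrite -[leRHS]mulr1 -mulrA ler_wpM2l//; first by rewrite mulr_ge0// ltW.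
by rewrite mulrAC ler_pdivrMr ?mul1r ?mulr_gt0// ltW.
Qed.

(** * Integrals of periodic extensions *)

(* Unlike the library's [ge0_le_integral], no measurability is required. *)
Lemma ge0_le_integral_nomeas d (T : measurableType d) (R : realType)
    (mu : {measure set T -> \bar R}) (D : set T) (f g : T -> \bar R) :
  (forall x, D x -> 0 <= f x)%E -> (forall x, D x -> f x <= g x)%E ->
  (\int[mu]_(x in D) f x <= \int[mu]_(x in D) g x)%E.
Proof.
move=> f0 fg.
have g0 x : D x -> (0 <= g x)%E by move=> Dx; exact: le_trans (f0 _ Dx) (fg _ Dx).
rewrite !ge0_integralE//; apply: le_ereal_sup => _ [h hf <-]; exists h => // x.
apply: le_trans (hf x) _; rewrite /patch; case: ifPn => // /set_mem; exact: fg.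
Qed.

Section translation.
Context {R : realType}.
Notation mu := (@lebesgue_measure R).

Let shift (r : R) : measurableTypeR R -> measurableTypeR R := fun x => x - r.

Let mshift r : measurable_fun setT (shift r).
Proof. exact: measurable_funB. Qed.

Lemma preimage_subr_itvoc (r p q : R) :
  (fun x => x - r) @^-1` `]p, q]%classic = `]r + p, r + q]%classic.
Proof.
by apply/seteqP; split => x /=; rewrite !in_itv/= => /andP[? ?]; apply/andP; split; lra.
Qed.

Let lebesgue_measure_shift r (A : set R) : measurable A ->
  pushforward mu (shift r) A = mu A.
Proof.
move=> mA; apply/esym/lebesgue_measure_unique => //= _ [[p q]] _ <-.
rewrite /pushforward /shift preimage_subr_itvoc !lebesgue_measure_itv/=.
by rewrite !lte_fin ltrD2l; case: ifP => // _; rewrite -!EFinD; congr EFin; lra.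
Qed.

Lemma measurable_fun_shift_itvoc (r p q : R) (f : R -> R) :
  measurable_fun `]p, q] f -> measurable_fun `]r + p, r + q] (fun x => f (x - r)).
Proof.
move=> mf; apply: (@measurable_comp _ _ _ _ _ _ `]p, q] f _ (shift r)) => //.
- by move=> _ [x] /[swap] <- /=; rewrite /shift !in_itv/= => /andP[? ?]; apply/andP; split; lra.
- exact: measurable_funTS (mshift r).
Qed.

Lemma ge0_integral_shift_itvoc (r p q : R) (f : R -> R) :
  measurable_fun `]p, q] f -> (forall x, 0 <= f x) ->
  (\int[mu]_(x in `](r + p)%R, (r + q)%R]) (f (x - r)%R)%:E =
   \int[mu]_(x in `]p, q]) (f x)%:E)%E.
Proof.
move=> mf f0; rewrite -preimage_subr_itvoc.
have mf' : measurable_fun `]p, q] (EFin \o f) by exact/measurable_EFinP.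
have := @ge0_integral_pushforward _ _ _ _ _ _ (mshift r) mu `]p, q] (EFin \o f).
move=> <-//; last by move=> y _ /=; rewrite lee_fin.
by apply: eq_measure_integral => //= A mA AS; exact: lebesgue_measure_shift.
Qed.

End translation.

Section periodic_extension.
Context {R : realType}.
Notation mu := (@lebesgue_measure R).
Variable L : R.
Hypothesis L0 : 0 < L.

Lemma PextE (f : R -> R) (i : int) w : i%:~R * L < w -> w <= i%:~R * L + L ->
  Pext L f w = f (w - i%:~R * L).
Proof.
move=> iw wi; rewrite /Pext (@ceil_def _ _ (i + 1)) ?addrK//.
by rewrite ltr_pdivlMr// iw/= ler_pdivrMr// intrD mulrDl mul1r.
Qed.

(** Half-open intervals make adjacent windows disjoint and match the cells of [Pext]; measurability
    is carried along for the additivity of the integral. *)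
Definition has_integral (f : R -> R) (u v : R) (I : \bar R) :=
  measurable_fun `]u, v] f /\ (\int[mu]_(x in `]u, v]) (f x)%:E = I)%E.

Lemma has_integral_cat f u v w I J : (forall x, 0 <= f x) -> u <= v -> v <= w ->
  has_integral f u v I -> has_integral f v w J -> has_integral f u w (I + J)%E.
Proof.
move=> f0 uv vw [mI <-] [mJ <-]; rewrite /has_integral.
have mU : measurable_fun (`]u, v] `|` `]v, w]) f by exact/measurable_funU.
rewrite (@itv_bndbnd_setU _ _ _ (BRight v)) ?bnd_simp//; split => //.
rewrite ge0_integral_setU//; first exact/measurable_EFinP.
  by move=> x _; rewrite lee_fin.
apply/disj_setPS => x [] /=; rewrite !in_itv/= => /andP[_ xv] /andP[vx _].
by move: (lt_le_trans vx xv); rewrite ltxx.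
Qed.

Lemma has_integral_Pext (f : R -> R) (i : int) p q I : (forall x, 0 <= f x) ->
  0 <= p -> q <= L -> has_integral f p q I ->
  has_integral (Pext L f) (i%:~R * L + p) (i%:~R * L + q) I.
Proof.
move=> f0 p0 qL [mf <-].
have E : {in `]i%:~R * L + p, i%:~R * L + q]%classic,
    (fun x => f (x - i%:~R * L)) =1 Pext L f}.
  by move=> x; rewrite inE/= in_itv/= => /andP[px xq]; rewrite (@PextE f i)//; lra.
split.
  by apply: eq_measurable_fun E _; exact: measurable_fun_shift_itvoc.
rewrite -(@ge0_integral_shift_itvoc _ (i%:~R * L) p q f)//.
by apply: eq_integral => x xI; rewrite (E x xI).
Qed.

Lemma has_integral_Pext_periods (f : R -> R) (i : int) (n : nat) (I : R) :
  (forall x, 0 <= f x) -> has_integral f 0 L I%:E ->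
  has_integral (Pext L f) (i%:~R * L) ((i + n%:Z)%:~R * L) (I *+ n)%:E.
Proof.
move=> f0 fI; have Pf0 x : 0 <= Pext L f x by exact: f0.
elim: n => [|n IH].
  rewrite addr0 mulr0n /has_integral set_itv_ge ?bnd_simp ?ltxx//.
  by rewrite integral_set0; split => //; exact: measurable_fun_set0.
have := has_integral_Pext (i + n%:Z) f0 (lexx 0) (lexx L) fI.
rewrite addr0 => H; rewrite mulrSr EFinD.
have E : (i + n.+1%:Z)%:~R * L = (i + n%:Z)%:~R * L + L.
  have -> : n.+1%:Z = n%:Z + 1 by rewrite -addn1 PoszD.
  by rewrite addrA [in LHS]intrD mulrDl mul1r.
rewrite E; apply: (has_integral_cat Pf0 _ _ IH H).
  by rewrite ler_pM2r// ler_int lerDl.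
by rewrite lerDl ltW.
Qed.

Lemma period_decomp w : exists i : int, exists2 p, 0 < p <= L & w = i%:~R * L + p.
Proof.
pose i : int := Num.ceil (w / L) - 1; exists i.
exists (w - i%:~R * L); last by rewrite addrC subrK.
have /andP[] := ceil_itv (w / L); rewrite ltr_pdivlMr// -/i => iw.
rewrite ler_pdivrMr// -[Num.ceil _](subrK 1) -/i intrD mulrDl mul1r => wi.
by apply/andP; split; lra.
Qed.

(* A window [u, v] splits into at most two partial periods and whole periods
   in between, so additive lower bounds survive with the constant doubled. *)
Lemma Pext_integral_ge (f F : R -> R) kk kp B u v : (forall x, 0 <= f x) ->
  (forall p q, 0 <= p -> p <= q -> q <= L -> has_integral f p q (F q - F p)%:E) ->
  0 <= B -> kp <= kk ->
  (forall p q, 0 <= p -> p <= q -> q <= L -> kk * (q - p) - B <= F q - F p) ->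
  kp * L <= F L - F 0 ->
  u <= v -> exists2 I, has_integral (Pext L f) u v I%:E & kp * (v - u) - 2 * B <= I.
Proof.
move=> f0 fF B0 kpk Flow FL uv; have Pf0 x : 0 <= Pext L f x by exact: f0.
have kpw p q : p <= q -> kp * (q - p) <= kk * (q - p).
  by move=> pq; rewrite ler_wpM2r// subr_ge0.
have [i [p /andP[p0 pL] Eu]] := period_decomp u.
have [j [q /andP[q0 qL] Ev]] := period_decomp v.
(* If the periods of [u] and [v] differ, the window is the end of the first, [n] whole periods and
   the start of the last. *)
have [ij|ji|ij] := ltgtP i j.
- have [n En] : exists n : nat, j = i + 1 + n%:Z.
    exists `|(j - (i + 1))%R|%N; rewrite gez0_abs ?subr_ge0 ?lezD1//.
    by rewrite addrC subrK.
  have i1 : (i + 1)%:~R * L = i%:~R * L + L by rewrite intrD mulrDl mul1r.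
  have I1 := has_integral_Pext i f0 (ltW p0) (lexx L) (fF _ _ (ltW p0) pL (lexx L)).
  have I2 := has_integral_Pext_periods (i + 1) n f0 (fF _ _ (lexx 0) (ltW L0) (lexx L)).
  have I3 := has_integral_Pext j f0 (lexx 0) qL (fF _ _ (lexx 0) (ltW q0) qL).
  rewrite -En in I2; rewrite -i1 -Eu in I1; rewrite addr0 -Ev in I3.
  have u1 : u <= (i + 1)%:~R * L by rewrite i1 Eu lerD2l.
  have jL : j%:~R * L = (i + 1)%:~R * L + L *+ n.
    by rewrite En intrD mulrDl -pmulrn mulr_natl.
  have le1j : (i + 1)%:~R * L <= j%:~R * L by rewrite jL lerDl mulrn_wge0// ltW.
  have ujv := has_integral_cat Pf0 u1 le1j I1 I2.
  have jv : j%:~R * L <= v by rewrite Ev lerDl ltW.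
  have := has_integral_cat Pf0 (le_trans u1 le1j) jv ujv I3.
  rewrite -!EFinD => H; exists (F L - F p + (F L - F 0) *+ n + (F q - F 0)) => //.
  have := Flow _ _ (ltW p0) pL (lexx L); have := Flow _ _ (lexx 0) (ltW q0) qL.
  have := kpw _ _ pL; have := kpw _ _ (ltW q0).
  (* Whole periods are estimated at rate [kp] without loss; only the two partial pieces cost [B]
     each. *)
  have : kp * (L *+ n) <= (F L - F 0) *+ n by rewrite mulrnAr lerMn2r FL orbT.
  have -> : v - u = (L - p) + L *+ n + (q - 0) by rewrite Ev Eu jL i1; lra.
  by rewrite !mulrDr; lra.
- exfalso; move: uv; rewrite Eu Ev.
  have : (j + 1)%:~R * L <= i%:~R * L by rewrite ler_pM2r// ler_int lezD1.
  by rewrite intrD mulrDl mul1r; lra.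
- have pq : p <= q by move: uv; rewrite Eu Ev ij lerD2l.
  exists (F q - F p).
    by rewrite Eu Ev ij; exact: (has_integral_Pext j f0 (ltW p0) qL (fF _ _ (ltW p0) pq qL)).
  have := Flow _ _ (ltW p0) pq qL; have := kpw _ _ pq.
  have -> : v - u = q - p by rewrite Eu Ev ij; lra.
  by lra.
Qed.

(** The shifted window cuts the period once, at [p], and contains translates of the parts of [f]
    after and before [p]. Hence undamped transport preserves the L2 norm. *)
Lemma Pext_integral_shift (f : R -> R) s : (forall x, 0 <= f x) ->
  measurable_fun `]0, L] f ->
  measurable_fun `]0, L] (fun w => Pext L f (w - s)) /\
  (\int[mu]_(w in `]0%R, L]) (Pext L f (w - s)%R)%:E =
   \int[mu]_(w in `]0%R, L]) (f w)%:E)%E.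
Proof.
move=> f0 mf; have Pf0 x : 0 <= Pext L f x by exact: f0.
have [i [p /andP[p0 pL] Es]] := period_decomp (- s).
have mp : measurable_fun `]0, p] f.
  by apply: measurable_funS mf => //; apply: subset_itvl; rewrite bnd_simp.
have mL : measurable_fun `]p, L] f.
  by apply: measurable_funS mf => //; apply: subset_itvr; rewrite bnd_simp ltW.
have I1 := has_integral_Pext i f0 (ltW p0) (lexx L) (conj mL erefl).
have I2 := has_integral_Pext (i + 1) f0 (lexx 0) pL (conj mp erefl).
have i1 : (i + 1)%:~R * L = i%:~R * L + L by rewrite intrD mulrDl mul1r.
have [_ fL] := has_integral_cat f0 (ltW p0) pL (conj mp erefl) (conj mL erefl).
rewrite addr0 i1 in I2.
have [] := has_integral_cat Pf0 _ _ I1 I2; [by rewrite lerD2l|by rewrite lerDl ltW|].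
rewrite -Es (_ : i%:~R * L + L + p = - s + L); last by rewrite Es; lra.
move=> mP IP; have := @measurable_fun_shift_itvoc _ s _ _ _ mP.
have := @ge0_integral_shift_itvoc _ s _ _ _ mP Pf0.
rewrite subrr addrA subrr add0r => -> ?; split => //.
by rewrite IP fL addeC.
Qed.

End periodic_extension.

(** * Integrals of the damping [kB] *)

Lemma lebesgue_measure_cc_oc (R : realType) (a b p q : R) : a <= b -> p <= q ->
  lebesgue_measure (`[a, b]%classic `&` `]p, q]%classic) =
  ((Num.min q b - Num.min q a) - (Num.min p b - Num.min p a))%:E.
Proof.
move=> ab pq; rewrite -set_itvI lebesgue_measure_itv/=.
rewrite joinEtotal meetEtotal lte_fin.
case: (leP a p) => ?; case: (leP b q) => ?; case: (leP a q) => ?;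
  case: (leP p b) => ?; try case: ltP => ?; rewrite -?EFinD; congr EFin; lra.
Qed.

(** All indicators from index [N] on vanish at [w], so the partial sums are eventually constant. The
    inequality is strict because the closed interval of actuator [N] contains [a N]. *)
Lemma kBE (R : realType) (a b k : nat -> R) N w : actuators a b -> w < a N ->
  kB a b k w = \sum_(0 <= j < N) k j * \1_(`[a j, b j]%classic) w.
Proof.
move=> act wN; rewrite /kB; apply: cvg_lim => //; apply: cvg_near_cst; near=> n.
have Nn : (N <= n)%N by near: n; exact: nbhs_infty_ge.
rewrite (big_cat_nat (leq0n N) Nn) /= [X in _ + X]big_nat [X in _ + X]big1 ?addr0//.
move=> j /andP[Nj _]; rewrite indicE memNset ?mulr0//= in_itv/=.
by have := actuators_le act Nj; lra.
Unshelve. all: by end_near. Qed.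

Lemma kB_ge0 (R : realType) (a b k : nat -> R) w : actuators a b ->
  (forall r, exists j, r < a j) -> (forall j, 0 < k j) -> 0 <= kB a b k w.
Proof.
move=> act unb k0; have [N wN] := unb w; rewrite (kBE _ act wN).
by apply: sumr_ge0 => j _; rewrite mulr_ge0 ?(ltW (k0 j)).
Qed.

(** Termwise, the overlap of actuator [j] with the window, weighted by [k j], is the increment of
    the [j]-th summand of [cumk]. *)
Lemma has_integral_kB (R : realType) (a b k : nat -> R) N p q : actuators a b ->
  (forall j, 0 < k j) -> p <= q -> q < a N ->
  has_integral (kB a b k) p q (cumk a b k N q - cumk a b k N p)%:E.
Proof.
move=> act k0 pq qN; have [_ ab _] := act.
have E : {in `]p, q]%classic,
    (fun w => \sum_(0 <= j < N) k j * \1_(`[a j, b j]%classic) w) =1 kB a b k}.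
  by move=> w; rewrite inE/= in_itv/= => /andP[_ wq]; rewrite (kBE _ act (le_lt_trans wq qN)).
have mI j : measurable_fun `]p, q] (fun w => k j * \1_(`[a j, b j]%classic) w).
  by apply: measurable_funM => //; exact: measurable_indic.
have mEI j : measurable_fun `]p, q] (EFin \o (fun w => k j * \1_(`[a j, b j]%classic) w)).
  by apply/measurable_EFinP; exact: (mI j).
split.
  by apply: eq_measurable_fun E _; exact: measurable_sum.
transitivity (\int[@lebesgue_measure R]_(w in `]p, q])
    (\sum_(0 <= j < N) (k j * \1_(`[a j, b j]%classic) w)%:E))%E.
  by apply: eq_integral => w wI; rewrite -(E w wI) sumEFin.
rewrite ge0_integral_sum//; last first.
  by move=> j w _; rewrite lee_fin mulr_ge0// ltW.
rewrite /cumk -sumrB -sumEFin; apply: eq_bigr => j _.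
under eq_integral do rewrite EFinM.
rewrite ge0_integralZl//; last 2 first.
- by apply/measurable_EFinP; exact: measurable_indic.
- by rewrite lee_fin ltW.
rewrite integral_indic//.
by rewrite [X in (_ * X)%E](lebesgue_measure_cc_oc (ltW (ab j)) pq) -EFinM mulrBr.
Qed.

(** * Decay estimates *)

Lemma has_integral_Rintegral (R : realType) (f : R -> R) (u v I : R) :
  has_integral f u v I%:E ->
  Rintegral (@lebesgue_measure R) `[u, v]%classic f = I.
Proof.
move=> [mf fI]; rewrite /Rintegral -integral_itv_obnd_cbnd ?fI//.
exact/measurable_EFinP.
Qed.

Lemma gap_bound_decay (R : realType) (c : R) (a b k : nat -> R) (M kk : R) :
  0 < c -> actuators a b -> (forall r, exists j, r < a j) ->
  (forall j, 0 < k j) -> 0 < M -> 0 < kk -> gap_bound a b k M kk ->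
  exists Mt kt : R, 0 < Mt /\ 0 < kt /\
     forall L t : R, 0 < L -> 0 <= t ->
     forall x0 : R -> R, measurable_fun `[0, L] x0 ->
       (L2sq L (Tphi c a b k L t x0) <= ((Mt * expR (- kt * t)) ^+ 2)%:E * L2sq L x0)%E.
Proof.
move=> c0 act unb k0 M0 kk0 gap; have [a0 ab _] := act.
have [kp /andP[kp0 kpk] Kper] := ge_cumk_period act k0 M0 kk0 gap.
pose B := M + kk * b 0%N.
have B0 : 0 <= B by rewrite addr_ge0 ?mulr_ge0 ?ltW// -a0.
(* A window of length [c * t] carries damping at least [kp * (c * t) - 2 * B]; division by [c] gives
   the rate [kp] and this factor, both independent of [L]. *)
exists (expR (2 * B / c)), kp; rewrite expR_gt0; split=> //; split=> // L t L0 t0 x0 mx0.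
have [N LN] := unb L.
have kB0 x : 0 <= kB a b k x by exact: kB_ge0.
set C := expR _ * expR _.
have decay w : expR (- c^-1 * Rintegral (@lebesgue_measure R) `[w - c * t, w]%classic
    (Pext L (kB a b k))) <= C.
  have uw : w - c * t <= w by rewrite gerBl mulr_ge0// ltW.
  have [|||I HI low] := @Pext_integral_ge _ _ L0 (kB a b k) (cumk a b k N) kk kp B
      (w - c * t) w kB0 _ B0 kpk _ _ uw.
  - by move=> p q _ pq qL; apply: has_integral_kB => //; exact: le_lt_trans LN.
  - by move=> p q p0 pq qL; apply: ge_cumk => //; exact: le_lt_trans LN.
  - by rewrite (cumk0 _ _ act) subr0; exact: Kper.
  rewrite (has_integral_Rintegral HI) /C -expRD ler_expR.
  rewrite -(ler_pM2l c0).
  have -> : c * (- c^-1 * I) = - I by field; rewrite gt_eqF.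
  have -> : c * (2 * B / c + - kp * t) = 2 * B - kp * (c * t) by field; rewrite gt_eqF.
  by move: low; rewrite opprB addrCA subrr addr0; lra.
pose h x := x0 x ^+ 2.
have h0 x : 0 <= h x by exact: sqr_ge0.
have mh : measurable_fun `]0, L] h.
  by apply: measurable_funX; exact/measurable_fun_itv_obnd_cbndP.
have [mPh Ph] := Pext_integral_shift L0 (c * t) h0 mh.
rewrite /L2sq.
(* [Pext] commutes with squaring, so after the pointwise bound by [C] only a shift of [h] remains,
   whose integral is unchanged. *)
apply: (@le_trans _ _ (\int[@lebesgue_measure R]_(w in `[0%R, L])
    ((C ^+ 2)%:E * (Pext L h (w - c * t)%R)%:E))%E).
  apply: ge0_le_integral_nomeas => w _; first by rewrite lee_fin sqr_ge0.
  rewrite -EFinM lee_fin /Tphi exprMn ler_wpM2r ?sqr_ge0//.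
  by rewrite ler_pXn2r ?nnegrE ?expR_ge0// mulr_ge0 ?expR_ge0.
rewrite -!integral_itv_obnd_cbnd; last 2 first.
- exact/measurable_EFinP.
- by apply: measurable_funeM; exact/measurable_EFinP.
rewrite ge0_integralZl//; last 3 first.
- exact/measurable_EFinP.
- by move=> w _; rewrite lee_fin; exact: h0.
- by rewrite lee_fin sqr_ge0.
by rewrite Ph.
Qed.

(* Test on a pulse that travels from the right end b_m of an actuator onto the
   left end a_n of a later one; its width is chosen so that the actuator [n]
   contributes at most 1 to the damping. *)
Lemma decay_gap_bound (R : realType) (c : R) (a b k : nat -> R) (Mt kt : R) :
  0 < c -> actuators a b -> (forall r, exists j, r < a j) ->
  (forall j, 0 < k j) -> 0 < Mt -> 0 < kt ->
  (forall L t : R, 0 < L -> 0 <= t ->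
     forall x0 : R -> R, measurable_fun `[0, L] x0 -> (L2sq L x0 < +oo)%E ->
       (L2sq L (Tphi c a b k L t x0) <= ((Mt * expR (- kt * t)) ^+ 2)%:E * L2sq L x0)%E) ->
  gap_bound a b k (c * `|ln Mt| + 1) kt.
Proof.
move=> c0 act unb k0 Mt0 kt0 decay n m; have [a0 ab ba] := act.
have M0 : 0 <= c * `|ln Mt| by rewrite mulr_ge0// ltW.
rewrite leq_eqVlt => /orP[/eqP->|mn].
  rewrite big_geq// subr0.
  have : kt * (a n - b n) <= 0 by rewrite pmulr_rle0// subr_le0 ltW.
  by lra.
pose e := Num.min (b n - a n) (k n)^-1.
have e0 : 0 < e by rewrite lt_min subr_gt0 ab invr_gt0 k0.
have eb : e <= b n - a n by rewrite ge_min lexx.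
have ke : k n * e <= 1.
  by rewrite mulrC -ler_pdivlMr ?k0// mul1r ge_min lexx orbT.
have bm0 : 0 < b m by rewrite (le_lt_trans _ (ab m))// -a0 (actuators_le act).
have bman : b m <= a n by rewrite (le_trans (ba m))// (actuators_le act).
have bn0 : 0 < b n by rewrite (lt_le_trans bm0)// (le_trans bman)// ltW.
set I := gain a b k n - gain a b k m.+1.
(* The travel time from [b m] to [a n]. With period [b n] and [e <= b n - a n] the whole journey
   stays inside one period, so [Pext] acts as the identity along it. *)
pose t := (a n - b m) / c.
have t0 : 0 <= t by rewrite divr_ge0 ?subr_ge0// ltW.
have ct : c * t = a n - b m by rewrite /t mulrC divfK// gt_eqF.
pose x0 : R -> R := \1_(`[b m, b m + e]%classic).
have mx0 : measurable_fun `[0, b n] x0 by exact: measurable_indic.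
have x0E : L2sq (b n) x0 = e%:E.
  transitivity (\int[@lebesgue_measure R]_(x in `[0%R, b n]) (x0 x)%:E)%E.
    apply: eq_integral => x _; rewrite /x0 indicE; by case: (_ \in _); rewrite ?expr1n ?expr0n.
  rewrite integral_indic// setIidl; last first.
    by move=> x /=; rewrite !in_itv/= => /andP[? ?]; apply/andP; split; lra.
  rewrite [LHS]lebesgue_measure_itv/= lte_fin ltrDl e0 -EFinD.
  by congr EFin; lra.
have kB0 x : 0 <= kB a b k x by exact: kB_ge0.
have [N bnN] := unb (b n).
have nN : (n < N)%N.
  by rewrite ltnNge; apply/negP => /(actuators_le act); have := ab n; lra.
have pulse w : a n <= w -> w <= a n + e ->
    expR (- (I + 1) / c) <= Tphi c a b k (b n) t x0 w.
  move=> aw wa; rewrite /Tphi ct.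
  have P (f : R -> R) x : 0 < x -> x <= b n -> Pext (b n) f x = f x.
    by move=> ? ?; rewrite (@PextE _ _ bn0 f 0) ?mul0r ?subr0 ?add0r.
  rewrite P; [|lra|lra].
  rewrite /x0 indicE mem_set ?mulr1; last first.
    by rewrite /= in_itv/=; apply/andP; split; lra.
  have HI : has_integral (Pext (b n) (kB a b k)) (w - (a n - b m)) w
      (cumk a b k N w - cumk a b k N (w - (a n - b m)))%:E.
    have := @has_integral_kB _ a b k N (w - (a n - b m)) w act k0.
    case; [lra|lra|move=> mk Ik].
    have E : {in `]w - (a n - b m), w]%classic, kB a b k =1 Pext (b n) (kB a b k)}.
      by move=> x; rewrite inE/= in_itv/= => /andP[? ?]; rewrite P//; lra.
    split; first exact: eq_measurable_fun E mk.
    by rewrite -Ik; apply: eq_integral => x /E ->.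
  rewrite (has_integral_Rintegral HI) ler_expR mulrC mulNr mulrN lerN2.
  rewrite ler_pM2l ?invr_gt0//.
  (* The window ends at most [e] inside actuator [n], which adds at most [k n * e <= 1]. *)
  have K1 : cumk a b k N w <= gain a b k n + 1.
    rewrite (cumkE k act nN aw); last by rewrite (le_trans wa)// (le_trans _ (ba n)); lra.
    rewrite lerD2l (le_trans _ ke)// ler_pM2l// (min_idPl _); lra.
  (* The window starts at or after [b m], so the gain of actuators up to [m] is already accumulated
     there. *)
  have K2 : gain a b k m.+1 <= cumk a b k N (w - (a n - b m)).
    apply: (@le_trans _ _ (cumk a b k N (b m))); last by apply: le_cumk => //; lra.
    rewrite (cumkE k act (ltn_trans mn nN) (ltW (ab m)) (ba m)) gainS.
    by rewrite (min_idPl (lexx _)).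
  by rewrite /I; lra.
(* Only the arrived pulse is kept; its width [e] cancels against the squared norm of [x0]. *)
have low : ((expR (- (I + 1) / c) ^+ 2)%:E * e%:E <= L2sq (b n) (Tphi c a b k (b n) t x0))%E.
  have -> : e%:E = @lebesgue_measure R `[a n, a n + e]%classic.
    rewrite lebesgue_measure_itv/= lte_fin ltrDl e0 -EFinD.
    by congr EFin; lra.
  rewrite -integral_cst// integral_mkcond /L2sq [leRHS]integral_mkcond.
  apply: ge0_le_integral_nomeas => w _; rewrite /patch.
    by case: ifP => //; rewrite lee_fin sqr_ge0.
  case: ifPn => [/set_mem/=|_]; last by case: ifP => //; rewrite lee_fin sqr_ge0.
  rewrite in_itv/= => /andP[aw wa].
  rewrite mem_set /=; last by rewrite in_itv/=; apply/andP; split; lra.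
  have p := pulse w aw wa; rewrite lee_fin ler_pXn2r ?nnegrE ?expR_ge0//.
  exact: le_trans (expR_ge0 _) p.
have := le_trans low (decay _ _ bn0 t0 _ mx0 _).
rewrite x0E -!EFinM lee_fin ler_pM2r// ler_pXn2r ?nnegrE ?expR_ge0 ?mulr_ge0 ?expR_ge0 ?(ltW Mt0)//.
move=> /(_ (ltry _)).
(* Logarithms, multiplied by [c], give [kt * (a n - b m) <= I + 1 + c * ln Mt]. *)
rewrite -{1}(lnK Mt0) -expRD ler_expR -(ler_pM2l c0) => H.
have E1 : c * (- (I + 1) / c) = - (I + 1) by rewrite mulrC divfK// gt_eqF.
have E2 : c * (ln Mt + - kt * t) = c * ln Mt - kt * (a n - b m) by rewrite -ct; lra.
have H3 : c * ln Mt <= c * `|ln Mt| by rewrite ler_pM2l// ler_norm.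
rewrite sum_gain// -/I.
by move: H; rewrite E1 E2; lra.
Qed.

Theorem mainTheorem9 (R : realType) (c : R) (a b k : nat -> R)
  (hc : 0 < c)
  (ha0 : a 0%N = 0)
  (hab : forall j, a j < b j)
  (hba : forall j, b j <= a j.+1)
  (haunb : forall r : R, exists j, r < a j)
  (hkpos : forall j, 0 < k j)
  (hkbd : exists C : R, forall j, k j <= C) :
  (exists Mt kt : R, 0 < Mt /\ 0 < kt /\
     forall L t : R, 0 < L -> 0 <= t ->
     forall x0 : R -> R, measurable_fun `[0, L] x0 ->
       (L2sq L x0 < +oo)%E ->
       (L2sq L (Tphi c a b k L t x0) <= ((Mt * expR (- kt * t)) ^+ 2)%:E * L2sq L x0)%E)
  <->
  (exists M kk : R, 0 < M /\ 0 < kk /\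
     forall n m : nat, (m <= n)%N ->
       kk * (a n - b m) - \sum_(m.+1 <= j < n) k j * (b j - a j) <= M).
Proof.
have act : actuators a b by [].
split=> [[Mt [kt [Mt0 [kt0 decay]]]]|[M [kk [M0 [kk0 gap]]]]].
  (* The absolute value keeps the constant positive even for [Mt < 1]. *)
  exists (c * `|ln Mt| + 1), kt; split; last split=> //.
    by rewrite ltr_wpDl// mulr_ge0// ltW.
  exact: (decay_gap_bound hc act haunb hkpos Mt0 kt0 decay).
have [Mt [kt [Mt0 [kt0 H]]]] := gap_bound_decay hc act haunb hkpos M0 kk0 gap.
exists Mt, kt; do 2 split=> //; move=> L t L0 t0 x0 mx0 _; exact: H.
Qed.
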